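(* Every finite containment-free dual pseudohalfplane-hypergraph has a $3$-shallow hitting set, and every finite containment-free pseudohemisphere-hypergraph has a $4$-shallow hitting set.
   Context: All hypergraphs are assumed to contain at least one hyperedge which is not the empty set. A hypergraph is containment-free if none of its hyperedges contains another hyperedge. A set $R$ of vertices is a $c$-shallow hitting set of $\mathcal H$ if $1\le |R\cap H|\le c$ for every $H\in\mathcal H$. A hypergraph $\mathcal F$ with an ordered vertex set is ABA-free if it does not contain two hyperedges $A$ and $B$ for which there are three vertices $x<y<z$ such that $x,z\in A\setminus B$ and $y\in B\setminus A$. For a hypergraph $\mathcal F$ on vertex set $S$, write $\bar F=S\setminus F$ and $\bar{\mathcal F}=\{\bar F\mid F\in\mathcal F\}$; $\Delta$ denotes symmetric difference. A hypergraph $\mathcal H$ on an ordered set $S$ is a pseudohalfplane-hypergraph if there exists an ABA-free hypergraph $\mathcal F$ on $S$ such that $\mathcal H\subset \mathcal F\cup\bar{\mathcal F}$. The dual of a hypergraph has the hyperedges of the original as vertices and the vertices of the original as hyperedges, with the same incidences. A dual pseudohalfplane-hypergraph is the dual of a pseudohalfplane-hypergraph. A pseudohemisphere-hypergraph is a hypergraph $\mathcal H$ on an ordered set of vertices $S$ such that there exist a set $X\subset S$ and an ABA-free hypergraph $\mathcal F$ on $S$ such that the hyperedges of $\mathcal H$ form a subset of $\{F\Delta X,\ \bar F\Delta X\mid F\in\mathcal F\}$. *)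

(* Defs.v *)
From mathcomp Require Import all_boot all_order.

Set Implicit Arguments.
Unset Strict Implicit.
Unset Printing Implicit Defensive.

(* A finite hypergraph is a set of subsets of its vertex type, so hyperedges
   carry no multiplicity. *)

Definition is_hypergraph (V : finType) (H : {set {set V}}) : Prop :=
  exists2 E : {set V}, E \in H & E != set0.

Definition containment_free (V : finType) (H : {set {set V}}) : Prop :=
  forall A B : {set V}, A \in H -> B \in H -> A \subset B -> A = B.

Definition shallow_hitting_set (V : finType) (c : nat) (H : {set {set V}})
    (R : {set V}) : Prop :=
  forall E : {set V}, E \in H -> 1 <= #|R :&: E| <= c.

(* Vertices of H with the same incidences give a single hyperedge of the
   dual. *)
Definition dual (V : finType) (H : {set {set V}}) :
    {set {set {E : {set V} | E \in H}}} :=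
  [set [set E : {E : {set V} | E \in H} | v \in val E] | v : V].

Definition complements (V : finType) (F : {set {set V}}) : {set {set V}} :=
  [set ~: E | E in F].

Definition symdiff (V : finType) (A B : {set V}) : {set V} :=
  (A :\: B) :|: (B :\: A).

Definition ABA_free (d : Order.disp_t) (S : finOrderType d)
    (F : {set {set S}}) : Prop :=
  forall A B : {set S}, A \in F -> B \in F ->
  ~ exists x y z : S,
      [/\ (x < y)%O, (y < z)%O, x \in A :\: B, z \in A :\: B & y \in B :\: A].

Definition pseudohalfplane_hypergraph (d : Order.disp_t) (S : finOrderType d)
    (H : {set {set S}}) : Prop :=
  is_hypergraph H /\
  exists F : {set {set S}},
    [/\ is_hypergraph F, ABA_free F & H \subset F :|: complements F].

Definition pseudohemisphere_hypergraph (d : Order.disp_t) (S : finOrderType d)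
    (H : {set {set S}}) : Prop :=
  is_hypergraph H /\
  exists (X : {set S}) (F : {set {set S}}),
    [/\ is_hypergraph F, ABA_free F &
        H \subset [set symdiff E X | E in F :|: complements F]].

(* Main.v *)
Require Import Defs.
From mathcomp Require Import all_boot all_order zify.

(** Both kinds of hypergraphs are governed by a locally transitive tournament.
Give each vertex of a linearly ordered set a sign, and orient a pair of equal
signs upwards and a pair of opposite signs downwards.  For vectors in space
this records which of two vectors comes first, within a half turn, when the
vectors are projected along a fixed vertical axis; the in-neighbourhoods and
the out-neighbourhoods are transitive.  If [F] is ABA-free and [X] is the set
of negative vertices, the sets [symdiff E X] with [E \in F] satisfy two rules
that no longer mention signs ([compatible]): for two members [A] and [B], no
transitive triple x -> y -> z, x -> z has x, z in [A :\: B] and y in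
[B :\: A], and no cyclic triple lies in [A :\: B].  So a
pseudohemisphere-hypergraph lies in [W :|: complements W] for a compatible
family [W] (its up-sets, with their complements as down-sets).  The dual of a
pseudohalfplane-hypergraph is itself a compatible family, with no complement
needed: a vertex E is positive if E lies in the ABA-free family and negative
otherwise, in which case [~: E] lies in it, and the vertices are ordered
lexicographically by these members of the family.

By the second rule, a cyclic triple inside one up-set meets every up-set, and
a cyclic triple inside one down-set meets every down-set.  If all hyperedges
are up-sets, the first fact gives a hitting set of size 3, unless no up-set
contains a cyclic triple.  In general, if cyclic triples C in an up-set and D
in a down-set exist, choose them with [#|C :|: D|] minimal: then [C :|: D]
hits everything, and a hyperedge containing five of its points would allow a
smaller choice ([union_le4]).  Up to complementing [W], it remains to treat
the case where no up-set contains a cyclic triple.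

In that case there is a notion of upper hull.  A vertex a is dominated by y
and z if y -> a -> z, y -> z and some member of [W] contains y and z but not
a; the vertices that are never dominated are extremal.  Domination is
transitive ([dominated_transl]), so each vertex is extremal or dominated by
two extremal ones ([extremal_covers]), and the extremal vertices hit all
up-sets.  Let R be an inclusion-minimal hitting set of extremal vertices.  If
an up-set A contained a -> b -> c from R, a -> c, a hyperedge B that meets R
only in b would be contained in A ([extremal_subset]), against
containment-freeness; so R is 2-shallow on up-sets.  For a down-set D, the
same argument applies to the points of R after, and to those before, a fixed
vertex outside D, which bounds [#|R :&: D|] by 4.

The extremal vertices hit the down-sets too when the tournament has a cyclic
triple: then some cyclic triple is made of extremal vertices
([covers_cyclic]), and no up-set contains it.  Otherwise the tournament is a
linear order, and R is chosen among the vertices extremal for [W] or for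
[complements W]; each hyperedge contains at most two points of R of either
kind. *)

Set Implicit Arguments.
Unset Strict Implicit.
Unset Printing Implicit Defensive.
Import Order.TTheory.

(** * Locally transitive tournaments and compatible families *)

Definition cyclic (V : finType) (arc : rel V) (x y z : V) : bool :=
  [&& arc x y, arc y z & arc z x].

(** The triple is transitive, with y in the middle. *)
Definition btw (V : finType) (arc : rel V) (x y z : V) : bool :=
  [&& arc x y, arc y z & arc x z].

(** A locally transitive tournament: neither an out-neighbourhood nor an
in-neighbourhood contains a cyclic triple. *)
Definition circular (V : finType) (arc : rel V) : Prop :=
  [/\ irreflexive arc,
      forall x y, x != y -> arc y x = ~~ arc x y,
      forall t x y z, arc t x -> arc t y -> arc t z -> ~~ cyclic arc x y z
    & forall t x y z, arc x t -> arc y t -> arc z t -> ~~ cyclic arc x y z].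

(** The sign-free form of the ABA-free condition.  Complementing both sets
exchanges [A :\: B] and [B :\: A], so the condition passes to the family of
complements. *)
Definition compatible (V : finType) (arc : rel V) (W : {set {set V}}) : Prop :=
  forall A B : {set V}, A \in W -> B \in W -> forall x y z,
    (btw arc x y z -> ~ [/\ x \in A :\: B, z \in A :\: B & y \in B :\: A]) /\
    (cyclic arc x y z -> ~ [/\ x \in A :\: B, y \in A :\: B & z \in A :\: B]).

Definition cyclic_free (V : finType) (arc : rel V) (A : {pred V}) : Prop :=
  forall x y z, x \in A -> y \in A -> z \in A -> ~~ cyclic arc x y z.

(** Reversing all arcs exchanges the two ends of a triple; it reduces the
statements about one side of a vertex to those about the other side. *)
Definition opp_arc (V : finType) (arc : rel V) : rel V := fun x y => arc y x.

Lemma circular_opp (V : finType) (arc : rel V) :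
  circular arc -> circular (opp_arc arc).
Proof.
case=> irr tot out inn; split=> [x|x y nxy|t x y z tx ty tz|t x y z xt yt zt].
- exact: irr.
- by rewrite /opp_arc; apply: tot; rewrite eq_sym.
- by move: (inn t z y x tz ty tx); rewrite /cyclic /opp_arc andbCA.
- by move: (out t z y x zt yt xt); rewrite /cyclic /opp_arc andbCA.
Qed.

Lemma cyclic_opp (V : finType) (arc : rel V) x y z :
  cyclic (opp_arc arc) x y z = cyclic arc z y x.
Proof. by rewrite /cyclic /opp_arc andbCA. Qed.

Lemma cyclic_rot (V : finType) (arc : rel V) x y z :
  cyclic arc x y z = cyclic arc y z x.
Proof. by rewrite /cyclic andbC -andbA. Qed.

Lemma btw_opp (V : finType) (arc : rel V) x y z :
  btw (opp_arc arc) x y z = btw arc z y x.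
Proof. by rewrite /btw /opp_arc andbCA. Qed.

Lemma compatible_opp (V : finType) (arc : rel V) (W : {set {set V}}) :
  compatible arc W -> compatible (opp_arc arc) W.
Proof.
move=> cW A B AW BW x y z; have [cb cc] := cW _ _ AW BW z y x.
by rewrite btw_opp cyclic_opp; split=> [/cb h [? ? ?]|/cc h [? ? ?]]; apply: h.
Qed.

Lemma cyclic_free_opp (V : finType) (arc : rel V) (A : {pred V}) :
  cyclic_free arc A -> cyclic_free (opp_arc arc) A.
Proof. by move=> fA x y z xA yA zA; rewrite cyclic_opp fA. Qed.

Lemma complementsP (V : finType) (W : {set {set V}}) (A : {set V}) :
  (A \in complements W) = (~: A \in W).
Proof.
apply/imsetP/idP => [[B BW ->]|AW]; first by rewrite setCK.
by exists (~: A); rewrite ?setCK.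
Qed.

Lemma complementsK (V : finType) : involutive (@complements V).
Proof. by move=> W; apply/setP=> A; rewrite !complementsP setCK. Qed.

Lemma compatible_complements (V : finType) (arc : rel V) (W : {set {set V}}) :
  compatible arc W -> compatible arc (complements W).
Proof.
move=> cW A B; rewrite !complementsP => AW BW x y z.
have := cW _ _ BW AW x y z; rewrite !inE !negbK.
by case=> cb cc; split=> [/cb|/cc]; rewrite ![(_ \notin _) && _]andbC.
Qed.

Section Circular.
Context (V : finType) (arc : rel V) (circ : circular arc).

Lemma arcxx x : arc x x = false.
Proof. by case: circ. Qed.

Lemma arcF x y : arc x y -> arc y x -> False.
Proof.
case: circ => irr tot _ _; case: (eqVneq x y) => [->|/tot ->]; first by rewrite irr.
by move=> ->.
Qed.

Lemma arc_total x y : x != y -> arc x y \/ arc y x.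
Proof. by case: circ => _ tot _ _ /tot ->; case: (arc x y); [left|right]. Qed.

Lemma out_cyclicF t x y z :
  arc t x -> arc t y -> arc t z -> arc x y -> arc y z -> arc z x -> False.
Proof.
case: circ => _ _ out _ tx ty tz xy yz zx.
by have := out t x y z tx ty tz; rewrite /cyclic xy yz zx.
Qed.

Lemma in_cyclicF t x y z :
  arc x t -> arc y t -> arc z t -> arc x y -> arc y z -> arc z x -> False.
Proof.
case: circ => _ _ _ inn tx ty tz xy yz zx.
by have := inn t x y z tx ty tz; rewrite /cyclic xy yz zx.
Qed.

Lemma arc_neq x y : arc x y -> x != y.
Proof. by apply: contraTneq => ->; rewrite arcxx. Qed.

Lemma arc_neq' x y : arc x y -> y != x.
Proof. by move/arc_neq; rewrite eq_sym. Qed.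

(** A vertex d outside a cyclic triple has both an in- and an out-neighbour in
it, hence forms a cyclic triple with two of its points. *)
Lemma cyclic_through x y z d : cyclic arc x y z -> d \notin [set x; y; z] ->
  exists p q, [/\ p \in [set x; y; z], q \in [set x; y; z] & cyclic arc d p q].
Proof.
move=> /and3P[xy yz zx]; rewrite !inE !negb_or -andbA => /and3P[dx dy dz].
have [dx'|xd] := arc_total dx; have [dy'|yd] := arc_total dy;
  have [dz'|zd] := arc_total dz.
- by case: (out_cyclicF dx' dy' dz').
- by exists y, z; rewrite !inE !eqxx !orbT /cyclic dy' yz zd.
- by exists x, y; rewrite !inE !eqxx !orbT /cyclic dx' xy yd.
- by exists x, y; rewrite !inE !eqxx !orbT /cyclic dx' xy yd.
- by exists z, x; rewrite !inE !eqxx !orbT /cyclic dz' zx xd.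
- by exists y, z; rewrite !inE !eqxx !orbT /cyclic dy' yz zd.
- by exists z, x; rewrite !inE !eqxx !orbT /cyclic dz' zx xd.
- by case: (in_cyclicF xd yd zd).
Qed.

Lemma three_btw (A : {set V}) : cyclic_free arc A -> 2 < #|A| ->
  exists x y z, [/\ x \in A, y \in A, z \in A & btw arc x y z].
Proof.
move=> fA /card_gt2P[x [y [z [[xA yA zA] [nxy nyz nzx]]]]].
have cf1 := fA _ _ _ xA yA zA; have cf2 := fA _ _ _ zA yA xA.
rewrite /cyclic in cf1 cf2.
have [xy|yx] := arc_total nxy; have [yz|zy] := arc_total nyz;
  have [zx|xz] := arc_total nzx.
- by rewrite xy yz zx in cf1.
- by exists x, y, z; rewrite /btw xy yz xz.
- by exists z, x, y; rewrite /btw zx xy zy.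
- by exists x, z, y; rewrite /btw xz zy xy.
- by exists y, z, x; rewrite /btw yz zx yx.
- by exists y, x, z; rewrite /btw yx xz yz.
- by exists z, y, x; rewrite /btw zy yx zx.
- by rewrite zy yx xz in cf2.
Qed.

Lemma out_btw t (A : {set V}) : (forall x, x \in A -> arc t x) -> 2 < #|A| ->
  exists x y z, [/\ x \in A, y \in A, z \in A & btw arc x y z].
Proof.
move=> At; apply: three_btw => x y z /At tx /At ty /At tz.
by apply/negP=> /and3P[]; apply: (out_cyclicF tx ty tz).
Qed.

End Circular.

(** * Extremal vertices *)

(** With the members of [W] seen as upper half-planes, a lies between y and z
and below the segment that joins them. *)
Definition dominated (V : finType) (arc : rel V) (W : {set {set V}})
    (a y z : V) : bool :=
  btw arc y a z && [exists B in W, [&& y \in B, z \in B & a \notin B]].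

(** The vertices of the upper hull: those that no pair dominates. *)
Definition extremal (V : finType) (arc : rel V) (W : {set {set V}}) : {set V} :=
  [set a | [forall y, forall z, ~~ dominated arc W a y z]].

Section Dominance.
Context (V : finType) (arc : rel V) (W : {set {set V}}).

Lemma dominatedP a y z : reflect (btw arc y a z /\
    exists2 B, B \in W & [/\ y \in B, z \in B & a \notin B]) (dominated arc W a y z).
Proof.
apply: (iffP andP) => [] [bt ex]; split=> //.
  by have [B BW /and3P[? ? ?]] := exists_inP ex; exists B.
by case: ex => B BW [? ? ?]; apply/exists_inP; exists B => //; apply/and3P.
Qed.

Lemma extremalP a :
  reflect (forall y z, ~~ dominated arc W a y z) (a \in extremal arc W).
Proof. by rewrite inE; apply: 'forall_forallP. Qed.

Lemma extremalF a y z B : a \in extremal arc W -> B \in W -> btw arc y a z ->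
  y \in B -> z \in B -> a \in B.
Proof.
move=> /extremalP/(_ y z) nd BW bt yB zB; apply: contraR nd => aB.
by apply/dominatedP; split=> //; exists B.
Qed.

End Dominance.

Lemma dominated_opp (V : finType) (arc : rel V) (W : {set {set V}}) a y z :
  dominated (opp_arc arc) W a y z = dominated arc W a z y.
Proof.
by apply/dominatedP/dominatedP; rewrite btw_opp => [] [bt [B BW [? ? ?]]];
  split=> //; exists B.
Qed.

Lemma extremal_opp (V : finType) (arc : rel V) (W : {set {set V}}) :
  extremal (opp_arc arc) W = extremal arc W.
Proof.
apply/setP=> a; apply/extremalP/extremalP => h y z; last by rewrite dominated_opp.
by rewrite -[dominated _ _ _ _ _]dominated_opp.
Qed.

Section CycFreeFamily.
Context (V : finType) (arc : rel V) (W : {set {set V}}).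
Hypothesis circ : circular arc.
Hypothesis comp : compatible arc W.
Hypothesis free : forall A, A \in W -> cyclic_free arc A.

Lemma btwF A B x y z : A \in W -> B \in W -> btw arc x y z ->
  x \in A -> x \notin B -> z \in A -> z \notin B -> y \in B -> y \in A.
Proof.
move=> AW BW bt xA xB zA zB yB; apply/negPn/negP => yA.
have [h _] := comp AW BW x y z; apply: (h bt).
by rewrite !inE xA xB zA zB yA yB.
Qed.

Lemma freeF A x y z : A \in W -> x \in A -> y \in A -> z \in A ->
  arc x y -> arc y z -> arc z x -> False.
Proof.
move=> AW xA yA zA xy yz zx.
by have := free AW xA yA zA; rewrite /cyclic xy yz zx.
Qed.

(** A member of [W] that contains a vertex contains one of any two vertices
that dominate it. *)
Lemma dominated_hit A v y z : dominated arc W v y z -> A \in W -> v \in A ->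
  (y \in A) || (z \in A).
Proof.
case/dominatedP=> bt [B BW [yB zB vB]] AW vA; apply: contraR vB.
by rewrite negb_or => /andP[yA zA]; apply: (btwF BW AW bt).
Qed.

(** If a lies below the segment xz, and x below the segment yw, then a lies
below a segment between two of y, w, z. *)
Lemma dominated_transl a x z y w : dominated arc W a x z -> dominated arc W x y w ->
  [\/ dominated arc W a y z, dominated arc W a w z | dominated arc W a y w].
Proof.
move=> dax dxy; case/dominatedP: (dax) => /and3P[xa az xz] [B BW [xB zB aB]].
case/dominatedP: (dxy) => /and3P[yx xw yw] [A AW [yA wA xA]].
have domB p q : arc p a -> arc a q -> arc p q -> p \in B -> q \in B ->
    dominated arc W a p q.
  by move=> pa aq pq pB qB; apply/dominatedP; split; [apply/and3P|exists B].
have nay : a != y by apply/eqP=> eay; apply: (arcF circ xa); rewrite eay.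
have nzy : z != y by apply/eqP=> ezy; apply: (arcF circ xz); rewrite ezy.
have [aA|naA] := boolP (a \in A); have [ay|ya] := arc_total circ nay.
- have [eaw|naw] := eqVneq a w; first by case: (arcF circ yw); rewrite -eaw.
  have [aw|wa] := arc_total circ naw.
    by case: (in_cyclicF circ yw xw aw yx xa ay).
  by case: (freeF AW yA wA aA yw wa ay).
- have yB : y \in B.
    apply: contraNT xA => yB.
    by apply: (btwF AW BW _ yA yB aA aB xB); apply/and3P.
  have [zy|yz] := arc_total circ nzy; first by case: (freeF BW xB zB yB).
  by apply: Or31; apply: domB.
- have naw : a != w by apply: contraNneq naA => ->.
  have [aw|wa] := arc_total circ naw.
    by case: (in_cyclicF circ yw xw aw yx xa ay).
  have [zy|yz] := arc_total circ nzy; last first.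
    by case: (in_cyclicF circ yz xz az yx xa ay).
  have nwz : w != z by apply/eqP=> ewz; apply: (arcF circ wa); rewrite ewz.
  have [wz|zw] := arc_total circ nwz; last first.
    by case: (out_cyclicF circ xw xa xz wa az zw).
  have [yB|wB] := orP (dominated_hit dxy BW xB).
    by case: (freeF BW xB zB yB).
  by apply: Or32; apply: domB.
- have naw : a != w by apply: contraNneq naA => ->.
  have [aw|wa] := arc_total circ naw.
    by apply: Or33; apply/dominatedP; split; [apply/and3P|exists A].
  have nwz : w != z by apply/eqP=> ewz; apply: (arcF circ wa); rewrite ewz.
  have [wz|zw] := arc_total circ nwz; last first.
    by case: (out_cyclicF circ xw xa xz wa az zw).
  have [yB|wB] := orP (dominated_hit dxy BW xB); last by apply: Or32; apply: domB.
  have [zy|yz] := arc_total circ nzy; first by case: (freeF BW xB zB yB).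
  by apply: Or31; apply: domB.
Qed.

End CycFreeFamily.

Section ExtremalCover.
Context (V : finType) (arc : rel V) (W : {set {set V}}).
Hypothesis circ : circular arc.
Hypothesis comp : compatible arc W.
Hypothesis free : forall A, A \in W -> cyclic_free arc A.

Lemma dominated_transr a x z y w : dominated arc W a x z -> dominated arc W z y w ->
  [\/ dominated arc W a x w, dominated arc W a x y | dominated arc W a y w].
Proof.
rewrite -!(dominated_opp arc) => daz dzw.
apply: (dominated_transl (circular_opp circ) (compatible_opp comp) _ daz dzw).
by move=> A AW; apply/cyclic_free_opp/free.
Qed.

(** [T] spans v: it contains v or two vertices dominating v. *)
Definition covers (T : {set V}) (v : V) : bool :=
  (v \in T) || [exists y in T, exists z in T, dominated arc W v y z].

Lemma coversP (T : {set V}) v : reflect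
  (v \in T \/ exists y z, [/\ y \in T, z \in T & dominated arc W v y z]) (covers T v).
Proof.
apply: (iffP orP) => -[vT|]; try by left.
  by case/exists_inP=> y yT /exists_inP[z zT d]; right; exists y, z.
case=> y [z [yT zT d]]; right.
by apply/exists_inP; exists y => //; apply/exists_inP; exists z.
Qed.

Lemma dominated_neq a y z : dominated arc W a y z -> (y != a) && (z != a).
Proof.
by case/dominatedP=> /and3P[ya az _] _; rewrite (arc_neq circ ya) (arc_neq' circ az).
Qed.

(** A vertex dominated by two vertices that [T] spans is dominated by two
vertices of [T].  As a vertex never dominates itself, these can be used after
a is removed from [T]. *)
Lemma covers_dominated (T : {set V}) a x z :
  covers T x -> covers T z -> dominated arc W a x z ->
  exists y w, [/\ y \in T, w \in T & dominated arc W a y w].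
Proof.
have half : forall x z, covers T x -> z \in T -> dominated arc W a x z ->
    exists y w, [/\ y \in T, w \in T & dominated arc W a y w].
  move=> {}x {}z /coversP[xT|[y [w [yT wT dx]]]] zT da; first by exists x, z.
  by case: (dominated_transl circ comp free da dx) => d;
     [exists y, z|exists w, z|exists y, w].
move=> cx /coversP[zT|[y [w [yT wT dz]]]] da; first exact: half cx zT da.
case: (dominated_transr da dz) => d; last by exists y, w.
  exact: half cx wT d.
exact: half cx yT d.
Qed.

(** A minimal spanning set consists of extremal vertices: a dominated vertex
could be removed from it. *)
Lemma extremal_covers v : covers (extremal arc W) v.
Proof.
pose P (T : {set V}) := [forall v, covers T v].
have PT : P setT by apply/forallP=> x; rewrite /covers inE.
have [T /minsetP[/forallP cT minT] _] := minset_exists PT.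
suff sT : T \subset extremal arc W.
  case/coversP: (cT v) => [vT|[y [z [yT zT d]]]]; apply/coversP.
    by left; apply: (subsetP sT).
  by right; exists y, z; split; rewrite ?(subsetP sT).
apply/subsetP=> a aT; apply/extremalP=> x z; apply/negP=> da.
have [y [w [yT wT {}da]]] := covers_dominated (cT x) (cT z) da.
have /andP[nya nwa] := dominated_neq da.
have cov u : u \in T -> covers (T :\ a) u.
  move=> uT; apply/coversP; have [->|nua] := eqVneq u a; last first.
    by left; rewrite !inE nua.
  by right; exists y, w; rewrite !inE nya nwa.
suff PTa : P (T :\ a).
  by have := minT _ PTa (subsetDl _ _) => /setP/(_ a); rewrite !inE eqxx aT.
apply/forallP=> u; case/coversP: (cT u) => [/cov//|[p [q [pT qT d]]]].
by apply/coversP; right; apply: covers_dominated d; apply: cov.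
Qed.

Lemma extremal_hits A : A \in W -> A != set0 -> A :&: extremal arc W != set0.
Proof.
move=> AW /set0Pn[v vA]; apply/set0Pn.
case/coversP: (extremal_covers v) => [vT|[y [z [yT zT d]]]].
  by exists v; rewrite inE vA.
by have [yA|zA] := orP (dominated_hit comp d AW vA); [exists y|exists z];
  rewrite inE ?yA ?zA.
Qed.

(** A member of [W] that contains b but neither of the extremal vertices a and c
around b is confined to the interval between a and c. *)
Lemma extremal_between B a b c x : B \in W -> btw arc a b c ->
  a \in extremal arc W -> c \in extremal arc W -> a \notin B -> b \in B -> c \notin B ->
  x \in B -> btw arc a x c.
Proof.
move=> BW /and3P[ab bc ac] aT cT aB bB cB xB.
have [->|nxb] := eqVneq x b; first by apply/and3P.
have nxa : x != a by apply: contraNneq aB => <-.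
have nxc : x != c by apply: contraNneq cB => <-.
have aF p q : arc p a -> arc a q -> arc p q -> p \in B -> q \in B -> False.
  move=> pa aq pq pB qB; case/negP: aB; apply: (extremalF aT BW _ pB qB).
  exact/and3P.
have cF p q : arc p c -> arc c q -> arc p q -> p \in B -> q \in B -> False.
  move=> pc cq pq pB qB; case/negP: cB; apply: (extremalF cT BW _ pB qB).
  exact/and3P.
have [xa|ax] := arc_total circ nxa.
  have [xb|bx] := arc_total circ nxb; first by case: (aF x b).
  have [xc|cx] := arc_total circ nxc; last by case: (cF b x).
  by case: (in_cyclicF circ xc ac bc xa ab bx).
have [xc|cx] := arc_total circ nxc; first by apply/and3P.
have [xb|bx] := arc_total circ nxb; last by case: (cF b x).
by case: (out_cyclicF circ ax ab ac xb bc cx).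
Qed.

Lemma extremal_subset A B a b c : A \in W -> B \in W -> btw arc a b c ->
  a \in extremal arc W -> c \in extremal arc W -> a \in A -> c \in A ->
  a \notin B -> b \in B -> c \notin B -> B \subset A.
Proof.
move=> AW BW bt aT cT aA cA aB bB cB; apply/subsetP=> x xB.
have btx := extremal_between BW bt aT cT aB bB cB xB.
exact: (btwF comp AW BW btx).
Qed.

(** If t in [A] precedes a and c, then [A] cannot return between a and c,
since a is extremal and outside [A]. *)
Lemma extremal_disjoint A B t a b c : A \in W -> B \in W -> t \in A ->
  arc t a -> arc t c -> btw arc a b c ->
  a \in extremal arc W -> c \in extremal arc W -> a \notin A ->
  a \notin B -> b \in B -> c \notin B -> B \subset ~: A.
Proof.
move=> AW BW tA ta tc bt aT cT aA aB bB cB; apply/subsetP=> x xB.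
have /and3P[ax xc ac] := extremal_between BW bt aT cT aB bB cB xB.
rewrite inE; apply: contra aA => xA.
have ntx : t != x by apply/eqP=> etx; apply: (arcF circ ta); rewrite etx.
have [tx|xt] := arc_total circ ntx; last first.
  by case: (in_cyclicF circ tc ac xc ta ax xt).
by apply: (extremalF aT AW _ tA xA); apply/and3P.
Qed.

(** If x in a cyclic triple is dominated by p and q in [Y], then p, q and the
two other points of the triple contain a cyclic triple, which has fewer
points outside [Y]. *)
Lemma covers_cyclic (Y : {set V}) x y z : (forall v, covers Y v) ->
  cyclic arc x y z -> exists a b c, [/\ a \in Y, b \in Y, c \in Y & cyclic arc a b c].
Proof.
move=> cY; have [n] := ubnP ((x \notin Y) + (y \notin Y) + (z \notin Y)).
elim: n x y z => // n IHn.
have step x y z : x \notin Y -> (x \notin Y) + (y \notin Y) + (z \notin Y) < n.+1 ->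
    cyclic arc x y z -> exists a b c, [/\ a \in Y, b \in Y, c \in Y & cyclic arc a b c].
  move=> xY lt /and3P[xy yz zx].
  case/coversP: (cY x) => [xY'|]; first by rewrite xY' in xY.
  move=> [p [q [pY qY /dominatedP[/and3P[px xq pq] _]]]].
  have npy : p != y by apply/eqP=> epy; apply: (arcF circ px); rewrite epy.
  have [py|yp] := arc_total circ npy.
    have npz : p != z by apply/eqP=> epz; apply: (arcF circ yz); rewrite -epz.
    have [pz|zp] := arc_total circ npz.
      by case: (out_cyclicF circ px py pz xy yz zx).
    apply: (IHn p y z); last exact/and3P.
    by rewrite pY; rewrite xY in lt; exact: lt.
  have nqy : q != y by apply/eqP=> eqy; apply: (arcF circ yp); rewrite -eqy.
  have [qy|yq] := arc_total circ nqy; last first.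
    by case: (in_cyclicF circ xq yq pq xy yp px).
  apply: (IHn p q y); last exact/and3P.
  by rewrite pY qY; rewrite xY in lt; apply: leq_ltn_trans (leq_addr _ _) lt.
move=> x y z lt cxyz.
have [xY|] := boolP (x \in Y); last by move=> xY; apply: step lt cxyz.
have [yY|] := boolP (y \in Y); last first.
  by move=> yY; apply: (step y z x) => //; [rewrite addnC addnA|rewrite -cyclic_rot].
have [zY|] := boolP (z \in Y); last first.
  by move=> zY; apply: (step z x y) => //; [rewrite -addnA addnC|rewrite cyclic_rot].
by exists x, y, z.
Qed.

End ExtremalCover.

(** * Minimal hitting sets when no up-set contains a cyclic triple *)

Section Minimal.
Context (V : finType) (H : {set {set V}}).

(** Each point b of a minimal hitting set has a private hyperedge: one that
meets the set in b only. *)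
Lemma minimal_hitting (T : {set V}) :
  (forall E, E \in H -> E :&: T != set0) ->
  exists R : {set V}, [/\ R \subset T, forall E, E \in H -> 0 < #|R :&: E|
    & forall b, b \in R -> exists2 E, E \in H & R :&: E = [set b]].
Proof.
move=> hT; pose P (R : {set V}) := [forall E in H, R :&: E != set0].
have PT : P T by apply/forall_inP=> E /hT; rewrite setIC.
have [R /minsetP[/forall_inP hR minR] sRT] := minset_exists PT.
exists R; split=> // [E EH|b bR]; first by rewrite card_gt0 hR.
have : ~~ P (R :\ b).
  apply/negP=> PRb; have := minR _ PRb (subsetDl _ _) => /setP/(_ b).
  by rewrite !inE eqxx bR.
rewrite negb_forall => /existsP[E]; rewrite negb_imply negbK => /andP[EH /eqP e0].
exists E => //; apply/eqP; rewrite eqEsubset; apply/andP; split.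
  apply/subsetP=> x; rewrite !inE => /andP[xR xE]; apply/negPn/negP=> nxb.
  by have := in_set0 x; rewrite -e0 !inE nxb xR xE.
have /set0Pn[x] := hR _ EH; rewrite !inE => /andP[xR xE].
have [xb|nxb] := eqVneq x b; first by rewrite sub1set !inE -xb xR xE.
by have := in_set0 x; rewrite -e0 !inE nxb xR xE.
Qed.

Lemma privateF (R E : {set V}) b x : R :&: E = [set b] -> x \in R -> x != b ->
  x \notin E.
Proof.
by move=> /setP/(_ x) + xR nxb; rewrite !inE xR (negPf nxb) /= => ->.
Qed.

Lemma private_in (R E : {set V}) b : R :&: E = [set b] -> b \in E.
Proof. by move/setP/(_ b); rewrite !inE eqxx => /andP[]. Qed.

End Minimal.

Section CycFreeShallow.
Context (V : finType) (arc : rel V) (W H : {set {set V}}).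
Hypothesis circ : circular arc.
Hypothesis comp : compatible arc W.
Hypothesis free : forall A, A \in W -> cyclic_free arc A.
Hypothesis sHW : H \subset W :|: complements W.
Hypothesis cfH : containment_free H.
Context (R : {set V}).
Hypothesis privR : forall b, b \in R -> exists2 E, E \in H & R :&: E = [set b].

Lemma in_updown E : E \in H -> E \in W \/ ~: E \in W.
Proof.
by move/(subsetP sHW); rewrite inE complementsP => /orP[]; [left|right].
Qed.

Lemma subset_same A B x : A \in H -> B \in H -> x \in A -> x \notin B ->
  ~ B \subset A.
Proof. by move=> AH BH xA xB /(cfH BH AH) eBA; rewrite eBA xA in xB. Qed.

(** The private hyperedge of b is an up-set: otherwise its complement would
witness that a and c dominate b. *)
Lemma private_extremal a b c :
  a \in R -> c \in R -> btw arc a b c -> b \in R :&: extremal arc W ->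
  exists B, [/\ B \in H, B \in W & [/\ a \notin B, b \in B & c \notin B]].
Proof.
move=> aR cR bt; rewrite inE => /andP[bR bT].
have /and3P[ab bc ac] := bt; have [B BH RB] := privR bR.
have aB := privateF RB aR (arc_neq circ ab).
have cB := privateF RB cR (arc_neq' circ bc).
have bB := private_in RB.
exists B; split=> //; have [//|BW] := in_updown BH.
by have := extremalF bT BW bt; rewrite !inE => /(_ aB cB); rewrite bB.
Qed.

Lemma up_extremal_le2 A : A \in H -> A \in W -> #|R :&: extremal arc W :&: A| <= 2.
Proof.
move=> AH AW; rewrite leqNgt; apply/negP => gt2.
have fX : cyclic_free arc (R :&: extremal arc W :&: A).
  by move=> x y z /setIP[_ xA] /setIP[_ yA] /setIP[_ zA]; apply: (free AW).
have [a [b [c [/setIP[aRT aA] /setIP[bRT bA] /setIP[cRT cA] bt]]]] :=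
  three_btw circ fX gt2.
have [aR aT] := setIP aRT; have [cR cT] := setIP cRT.
have [B [BH BW [aB bB cB]]] := private_extremal aR cR bt bRT.
apply: (subset_same AH BH aA aB).
exact: (extremal_subset circ comp AW BW bt).
Qed.

(** The points of a down-set following a fixed vertex t outside it form a
transitive subtournament, to which [extremal_disjoint] applies. *)
Lemma down_out_le2 D t : D \in H -> ~: D \in W -> t \notin D ->
  #|R :&: extremal arc W :&: D :&: [set x | arc t x]| <= 2.
Proof.
move=> DH DW tD; rewrite leqNgt; apply/negP => gt2.
have [a [b [c [aX bX cX bt]]]] : exists x y z : V,
    [/\ x \in R :&: extremal arc W :&: D :&: [set x | arc t x],
        y \in R :&: extremal arc W :&: D :&: [set x | arc t x],
        z \in R :&: extremal arc W :&: D :&: [set x | arc t x]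
      & btw arc x y z].
  by apply: (out_btw circ (t := t)) gt2 => x /setIP[_]; rewrite inE.
have [/setIP[/setIP[aR aT] aD]] := setIP aX; rewrite inE => ta.
have [/setIP[/setIP[cR cT] cD]] := setIP cX; rewrite inE => tc.
have [/setIP[bRT bD] _] := setIP bX.
have [B [BH BW [aB bB cB]]] := private_extremal aR cR bt bRT.
apply: (subset_same DH BH aD aB); rewrite -[D]setCK.
apply: (extremal_disjoint circ DW BW (t := t) (a := a) (b := b) (c := c)) => //;
  by rewrite !inE ?negbK.
Qed.

(** By containment-freeness, the whole vertex set is a hyperedge only if it is
the only one. *)
Lemma full_edge_le1 D : D \in H -> D = setT -> #|R :&: D| <= 1.
Proof.
move=> DH DT; have [->|/set0Pn[b /setIP[bR _]]] := eqVneq (R :&: D) set0.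
  by rewrite cards0.
have [E EH RE] := privR bR.
by rewrite -(cfH EH DH) ?RE ?cards1 // DT subsetT.
Qed.

End CycFreeShallow.

Section CycFreeTheorem.
Context (V : finType) (arc : rel V) (W H : {set {set V}}).
Hypothesis circ : circular arc.
Hypothesis comp : compatible arc W.
Hypothesis free : forall A, A \in W -> cyclic_free arc A.
Hypothesis sHW : H \subset W :|: complements W.
Hypothesis cfH : containment_free H.
Hypothesis H0 : set0 \notin H.

Lemma down_extremal_le4 (R D : {set V}) :
  (forall b, b \in R -> exists2 E, E \in H & R :&: E = [set b]) ->
  D \in H -> ~: D \in W -> #|R :&: extremal arc W :&: D| <= 4.
Proof.
move=> privR DH DW; have [DT|] := eqVneq D setT.
  apply: leq_trans (_ : 1 <= _) => //.
  apply: leq_trans (full_edge_le1 cfH privR DH DT).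
  by apply/subset_leq_card/setSI/subsetIl.
(* The points of D are split into those after t and those before t. *)
rewrite -subTset => /subsetPn[t _ tD].
have out := down_out_le2 circ sHW cfH privR DH DW tD.
have inn := down_out_le2 (circular_opp circ) sHW cfH privR DH DW tD.
rewrite extremal_opp in inn.
apply: leq_trans (leq_add out inn); apply: leq_trans (leq_card_setU _ _).
apply/subset_leq_card/subsetP=> x xX.
rewrite in_setU [x \in _ :&: [set _ | arc _ _]]in_setI.
rewrite [x \in _ :&: [set _ | opp_arc _ _ _]]in_setI xX !inE /=.
apply/orP/(arc_total circ); apply: contraNneq tD => ->.
by case/setIP: xX.
Qed.

Lemma up_edges_shallow : H \subset W -> exists R, shallow_hitting_set 2 H R.
Proof.
move=> sH; have hT E : E \in H -> E :&: extremal arc W != set0.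
  move=> EH; apply: (extremal_hits circ comp free (subsetP sH _ EH)).
  by apply: contraNneq H0 => <-.
have [R [sRT hR privR]] := minimal_hitting hT.
exists R => E EH; rewrite hR //=.
have := up_extremal_le2 circ comp free sHW cfH privR EH (subsetP sH _ EH).
by rewrite (setIidPl sRT).
Qed.

Lemma cyclic_shallow x y z : cyclic arc x y z -> exists R, shallow_hitting_set 4 H R.
Proof.
move=> cxyz; have hT E : E \in H -> E :&: extremal arc W != set0.
  move=> EH; have [EW|EW] := in_updown sHW EH.
    apply: (extremal_hits circ comp free EW); by apply: contraNneq H0 => <-.
  apply/negP=> /eqP e0.
  have [a [b [c [aT bT cT cabc]]]] :=
    covers_cyclic circ (extremal_covers circ comp free) cxyz.
  have sT v : v \in extremal arc W -> v \in ~: E.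
    by move=> vT; rewrite inE; apply/negP=> vE; have := in_set0 v;
       rewrite -e0 inE vE vT.
  by have := free EW (sT _ aT) (sT _ bT) (sT _ cT); rewrite cabc.
have [R [sRT hR privR]] := minimal_hitting hT.
exists R => E EH; rewrite hR //= -(setIidPl sRT).
have [EW|EW] := in_updown sHW EH; last exact: down_extremal_le4.
exact: leq_trans (up_extremal_le2 circ comp free sHW cfH privR EH EW) _.
Qed.

End CycFreeTheorem.

(** * Tournaments without cyclic triples *)

Section Linear.
Context (V : finType) (arc : rel V) (W H : {set {set V}}).
Hypothesis circ : circular arc.
Hypothesis comp : compatible arc W.
Hypothesis lin : forall x y z, ~~ cyclic arc x y z.
Hypothesis sHW : H \subset W :|: complements W.
Hypothesis cfH : containment_free H.
Context (R : {set V}).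
Hypothesis privR : forall b, b \in R -> exists2 E, E \in H & R :&: E = [set b].

(** The vertices of the lower hull. *)
Let coextremal := extremal arc (complements W).

Lemma linF A : cyclic_free arc A. Proof. by move=> x y z _ _ _. Qed.

Lemma lin_btw x y z : arc x y -> arc y z -> btw arc x y z.
Proof.
move=> xy yz; rewrite /btw xy yz /=.
have nxz : x != z by apply/eqP=> exz; apply: (arcF circ yz); rewrite -exz.
have [//|zx] := arc_total circ nxz.
by have := lin x y z; rewrite /cyclic xy yz zx.
Qed.

(** A vertex that is extremal for the complements lies outside a member of [W]
as soon as a vertex on each side of it does. *)
Lemma coextremalF A a y z : a \in coextremal -> A \in W -> arc y a -> arc a z ->
  y \notin A -> z \notin A -> a \notin A.
Proof.
move=> aT AW ya az yA zA.
have := extremalF aT (B := ~: A) _ (lin_btw ya az).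
by rewrite complementsP setCK !inE; apply.
Qed.

(** If [A] missed t between b and c, the private hyperedge of a would be
contained in [A]. *)
Lemma up_coextremal_gap A a b c t : A \in H -> A \in W ->
  a \in R -> b \in R :&: coextremal -> c \in R :&: coextremal ->
  a \in A -> b \in A -> c \in A ->
  arc a b -> arc b t -> arc t c -> t \in A.
Proof.
move=> AH AW aR /setIP[bR bT] /setIP[cR cT] aA bA cA ab bt tc.
apply/negPn/negP => tA.
have /and3P[_ _ bc] := lin_btw bt tc; have /and3P[_ _ ac] := lin_btw ab bc.
have [B BH RB] := privR aR.
have aB := private_in RB.
have bB := privateF RB bR (arc_neq' circ ab).
have cB := privateF RB cR (arc_neq' circ ac).
apply: (subset_same cfH AH BH bA bB); apply/subsetP=> x xB.
apply/negPn/negP => xA.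
have nxb : x != b by apply: contraNneq bB => <-.
have [xb|bx] := arc_total circ nxb.
  by have := coextremalF bT AW xb bt xA tA; rewrite bA.
have [BW|BW] := in_updown sHW BH; last first.
  by have := coextremalF bT BW ab bx; rewrite !inE !negbK => /(_ aB xB);
     rewrite (negPf bB).
have nxc : x != c by apply: contraNneq cB => <-.
have [xc|cx] := arc_total circ nxc; last first.
  by have := coextremalF cT AW tc cx tA xA; rewrite cA.
case/negP: xA; exact: (btwF comp AW BW (lin_btw bx xc)).
Qed.

End Linear.

Section LinearTheorem.
Context (V : finType) (arc : rel V).
Hypothesis circ : circular arc.
Hypothesis lin : forall x y z, ~~ cyclic arc x y z.

Lemma up_coextremal_le2 (W H : {set {set V}}) (R A : {set V}) :
  compatible arc W -> H \subset W :|: complements W -> containment_free H ->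
  (forall b, b \in R -> exists2 E, E \in H & R :&: E = [set b]) ->
  A \in H -> A \in W -> #|R :&: extremal arc (complements W) :&: A| <= 2.
Proof.
move=> comp sHW cfH privR AH AW; rewrite leqNgt; apply/negP => gt2.
have [a [b [c [/setIP[aRT aA] /setIP[bRT bA] /setIP[cRT cA] bt]]]] :=
  three_btw circ (linF lin (A := mem _)) gt2.
have [[aR aT] [bR bT] [cR cT]] := And3 (setIP aRT) (setIP bRT) (setIP cRT).
have /and3P[ab bc ac] := bt.
have [B BH RB] := privR b bR.
have aB := privateF RB aR (arc_neq circ ab).
have cB := privateF RB cR (arc_neq' circ bc).
have bB := private_in RB.
have [BW|BW] := in_updown sHW BH.
  by have := coextremalF circ lin bT BW ab bc aB cB; rewrite bB.
apply: (subset_same cfH AH BH aA aB); apply/subsetP=> x xB.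
have BW' : B \in complements W by rewrite complementsP.
have /and3P[ax xc _] := extremal_between circ BW' bt aT cT aB bB cB xB.
(* A point of B between a and c and outside A would be a gap of A between b
   and one of a, c; the gap before b is the reversed form of the gap after b. *)
have [->//|nxb] := eqVneq x b; have [xb|bx] := arc_total circ nxb; last first.
  exact: (up_coextremal_gap circ comp lin sHW cfH privR AH AW aR bRT cRT).
apply: (up_coextremal_gap (circular_opp circ) (compatible_opp comp) _ sHW cfH privR
  AH AW cR (b := b) (c := a)) => //.
- by move=> p q r; rewrite cyclic_opp.
- by rewrite (extremal_opp arc).
- by rewrite (extremal_opp arc).
Qed.

Lemma up_le4 (W H : {set {set V}}) (R A : {set V}) :
  compatible arc W -> H \subset W :|: complements W -> containment_free H ->
  (forall b, b \in R -> exists2 E, E \in H & R :&: E = [set b]) ->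
  R \subset extremal arc W :|: extremal arc (complements W) ->
  A \in H -> A \in W -> #|R :&: A| <= 4.
Proof.
move=> comp sHW cfH privR sRT AH AW.
have le1 := up_extremal_le2 circ comp (fun A _ => linF lin (A := A)) sHW cfH
  privR AH AW.
have le2 := up_coextremal_le2 comp sHW cfH privR AH AW.
apply: leq_trans (leq_add le1 le2); apply: leq_trans (leq_card_setU _ _).
by rewrite -setIUl -setIUr (setIidPl sRT).
Qed.

Lemma linear_shallow (W H : {set {set V}}) :
  compatible arc W -> H \subset W :|: complements W -> containment_free H ->
  set0 \notin H -> exists R, shallow_hitting_set 4 H R.
Proof.
move=> comp sHW cfH H0; pose T := extremal arc W :|: extremal arc (complements W).
have compC := compatible_complements comp.
have hT E : E \in H -> E :&: T != set0.
  move=> EH; have E0 : E != set0 by apply: contraNneq H0 => <-.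
  have [EW|EW] := in_updown sHW EH; rewrite /T setIUr setU_eq0 negb_and.
    by rewrite (extremal_hits circ comp _ EW) // => A _; apply: linF.
  apply/orP; right; apply: (extremal_hits circ compC) => //.
    by move=> A _; apply: linF.
  by rewrite complementsP.
have [R [sRT hR privR]] := minimal_hitting hT.
exists R => E EH; rewrite hR //=; have [EW|EW] := in_updown sHW EH.
  exact: (up_le4 comp sHW).
apply: (up_le4 compC _ cfH privR _ EH); rewrite ?complementsP // complementsK.
  by rewrite setUC.
by rewrite setUC.
Qed.

End LinearTheorem.

Lemma cyclic_free_shallow (V : finType) (arc : rel V) (W H : {set {set V}}) :
  circular arc -> compatible arc W -> (forall A, A \in W -> cyclic_free arc A) ->
  H \subset W :|: complements W -> containment_free H -> set0 \notin H ->
  exists R, shallow_hitting_set 4 H R.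
Proof.
move=> circ comp free sHW cfH H0.
have [/existsP[x /existsP[y /existsP[z cxyz]]]|] :=
  boolP [exists x, exists y, exists z, cyclic arc x y z].
  exact: (cyclic_shallow circ comp free sHW cfH H0 cxyz).
move=> /existsPn lin; apply: (linear_shallow circ _ comp) => // x y z.
by have := lin x => /existsPn/(_ y)/existsPn/(_ z).
Qed.

(** * Cyclic triples inside up-sets and inside down-sets *)

Section TwoTriples.
Context (V : finType) (arc : rel V).
Hypothesis circ : circular arc.

(** The vertex sets of cyclic triples. *)
Definition cyclic_set (C : {set V}) : bool :=
  [exists x, exists y, exists z, (C == [set x; y; z]) && cyclic arc x y z].

Lemma cyclic_setP (C : {set V}) :
  reflect (exists x y z, C = [set x; y; z] /\ cyclic arc x y z) (cyclic_set C).
Proof.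
apply: (iffP existsP) => [[x /existsP[y /existsP[z /andP[/eqP-> c]]]]|].
  by exists x, y, z.
case=> x [y [z [-> c]]]; exists x; apply/existsP; exists y; apply/existsP.
by exists z; rewrite eqxx.
Qed.

Lemma cyclic_set_card (C : {set V}) : cyclic_set C -> #|C| <= 3.
Proof.
case/cyclic_setP=> x [y [z [-> _]]]; rewrite -setUA.
apply: leq_trans (leq_card_setU _ _) _; rewrite cards1.
by rewrite cards2; case: eqP.
Qed.

(** The cyclic triples contained in some member of [W]. *)
Definition up_cyclic (W : {set {set V}}) (C : {set V}) : bool :=
  cyclic_set C && [exists A in W, C \subset A].

Lemma up_cyclicP (W : {set {set V}}) (C : {set V}) :
  reflect (cyclic_set C /\ exists2 A, A \in W & C \subset A) (up_cyclic W C).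
Proof. by apply: (iffP andP) => -[cC /exists_inP]. Qed.

Lemma up_cyclic_hits (W : {set {set V}}) (C A : {set V}) :
  compatible arc W -> up_cyclic W C -> A \in W -> C :&: A != set0.
Proof.
move=> comp /up_cyclicP[/cyclic_setP[x [y [z [eC c]]]] [B BW sCB]] AW.
apply/negP=> /eqP CA0; have [_ /(_ c)] := comp _ _ BW AW x y z; apply.
have cB v : v \in C -> v \in B :\: A.
  move=> vC; rewrite !inE (subsetP sCB) // andbT; apply/negP=> vA.
  by have := in_set0 v; rewrite -CA0 inE vC vA.
by split; apply: cB; rewrite eC !inE eqxx ?orbT.
Qed.

Lemma union_le4 (W : {set {set V}}) (C D A : {set V}) : compatible arc W ->
  up_cyclic W C -> up_cyclic (complements W) D ->
  (forall C' D', up_cyclic W C' -> up_cyclic (complements W) D' ->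
    #|C :|: D| <= #|C' :|: D'|) ->
  A \in W -> #|(C :|: D) :&: A| <= 4.
Proof.
move=> comp uC uD minU AW; rewrite leqNgt; apply/negP=> gt4.
have [cC _] := up_cyclicP _ _ uC; have [cD _] := up_cyclicP _ _ uD.
have gt4U : 4 < #|C :|: D| by apply: leq_trans gt4 (subset_leq_card (subsetIl _ _)).
have [sDA|/subsetPn[e eD eA]] := boolP (D \subset A).
  have uD' : up_cyclic W D by apply/up_cyclicP; split => //; exists A.
  have := minU _ _ uD' uD; rewrite setUid => /(leq_trans gt4U).
  by move=> /leq_trans/(_ (cyclic_set_card cD)).
(* The union has exactly six points, C and D are disjoint, and the point e of D
   is the only one outside A; replacing C by a cyclic triple through a second point d
   of D lowers the size of the union. *)
have leU : #|C :|: D| + #|C :&: D| <= 6.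
  by rewrite cardsUI; apply: (leq_add (cyclic_set_card cC) (cyclic_set_card cD)).
have eU : e \in C :|: D by rewrite inE eD orbT.
have cardU := cardsD1 e (C :|: D); rewrite eU add1n in cardU.
have sAU : (C :|: D) :&: A \subset (C :|: D) :\ e.
  apply/subsetP=> v /setIP[vU vA]; rewrite in_setD1 vU andbT.
  by apply: contraNneq eA => <-.
have gt4e := leq_trans gt4 (subset_leq_card sAU).
have sUA : (C :|: D) :\ e \subset A.
  have /eqP<- : (C :|: D) :&: A == (C :|: D) :\ e; last exact: subsetIr.
  rewrite eqEcard sAU /=; apply: leq_trans gt4; rewrite -ltnS.
  by apply: leq_trans leU; rewrite cardU addSn ltnS leq_addr.
have gt5U : 5 < #|C :|: D| by rewrite cardU.
have CD0 : C :&: D = set0.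
  apply/eqP; rewrite -cards_eq0 -leqn0 -(leq_add2l 6).
  by apply: leq_trans leU; rewrite leq_add2r.
have [d dD nde] : exists2 d, d \in D & d != e.
  have : 0 < #|D :\ e|.
    have : 2 < #|D|.
      rewrite -(ltn_add2l 3); apply: (leq_trans gt5U).
      by apply: leq_trans (leq_card_setU C D) _; rewrite leq_add2r cyclic_set_card.
    by rewrite (cardsD1 e) eD add1n => /ltnW.
  by rewrite card_gt0 => /set0Pn[d /setD1P[nde dD]]; exists d.
have sCA : C \subset A.
  apply: subset_trans sUA; apply/subsetP=> v vC; rewrite !inE vC andbT.
  by apply/eqP=> ve; have := in_set0 v; rewrite -CD0 inE vC ve eD.
have dC : d \notin C.
  by apply/negP=> dC; have := in_set0 d; rewrite -CD0 inE dC dD.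
case/cyclic_setP: (cC) => x [y [z [eC c]]]; rewrite eC in dC.
have [p [q [pC qC cdpq]]] := cyclic_through circ c dC; rewrite -eC in pC qC.
have dA : d \in A by apply: (subsetP sUA); rewrite !inE nde dD orbT.
have uC' : up_cyclic W [set d; p; q].
  apply/up_cyclicP; split; first by apply/cyclic_setP; exists d, p, q.
  exists A => //; apply/subsetP=> v; rewrite !inE => /orP[/orP[]|] /eqP->//;
    exact: (subsetP sCA).
have := leq_trans gt5U (minU _ _ uC' uD); rewrite ltnNge => /negP; apply.
have sub : [set d; p; q] :|: D \subset [set p; q] :|: D.
  apply/subsetP=> v; rewrite !inE -!orbA => /or4P[/eqP->|->|->|->];
    by rewrite ?dD ?orbT.
apply: leq_trans (subset_leq_card sub) _.
apply: leq_trans (leq_card_setU _ _) _; rewrite -[5]/(2 + 3).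
apply: leq_add (cyclic_set_card cD).
by rewrite cards2; case: eqP.
Qed.

Lemma two_triples_shallow (W H : {set {set V}}) (C0 D0 : {set V}) :
  compatible arc W -> H \subset W :|: complements W ->
  up_cyclic W C0 -> up_cyclic (complements W) D0 -> exists R, shallow_hitting_set 4 H R.
Proof.
move=> comp sHW uC0 uD0.
pose P (CD : {set V} * {set V}) := up_cyclic W CD.1 && up_cyclic (complements W) CD.2.
have P0 : P (C0, D0) by rewrite /P uC0.
case: (arg_minnP (fun CD => #|CD.1 :|: CD.2|) P0) => -[C D] /andP[/= uC uD] minCD.
have {}minCD C' D' : up_cyclic W C' -> up_cyclic (complements W) D' ->
    #|C :|: D| <= #|C' :|: D'|.
  by move=> uC' uD'; apply: (minCD (C', D')); rewrite /P uC'.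
have compC := compatible_complements comp.
exists (C :|: D) => E EH; rewrite card_gt0 setIUl setU_eq0 negb_and -setIUl.
have [EW|EW] := in_updown sHW EH.
  by rewrite (up_cyclic_hits comp uC EW) /=; apply: (union_le4 comp uC uD).
rewrite -complementsP in EW.
rewrite (up_cyclic_hits compC uD EW) orbT setUC /=.
apply: (union_le4 compC uD _ _ EW); rewrite ?complementsK // => C' D' uC' uD'.
by rewrite setUC [C' :|: D']setUC; apply: minCD.
Qed.

Lemma up_cyclic_shallow (W : {set {set V}}) (C : {set V}) :
  compatible arc W -> up_cyclic W C -> shallow_hitting_set 3 W C.
Proof.
move=> comp uC E EW; rewrite card_gt0 (up_cyclic_hits comp uC EW) /=.
apply: leq_trans (subset_leq_card (subsetIl _ _)) _.
by case/up_cyclicP: uC => /cyclic_set_card.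
Qed.

Lemma no_up_cyclic (W : {set {set V}}) : ~~ [exists C, up_cyclic W C] ->
  forall A, A \in W -> cyclic_free arc A.
Proof.
move=> /existsPn noC A AW x y z xA yA zA; apply/negP=> c.
have /negP[] := noC [set x; y; z]; apply/up_cyclicP; split.
  by apply/cyclic_setP; exists x, y, z.
by exists A => //; apply/subsetP=> v; rewrite !inE => /orP[/orP[]|] /eqP->.
Qed.

Lemma compatible_shallow (W H : {set {set V}}) :
  compatible arc W -> H \subset W :|: complements W ->
  containment_free H -> set0 \notin H -> exists R, shallow_hitting_set 4 H R.
Proof.
move=> comp sHW cfH H0; have compC := compatible_complements comp.
have [/existsP[C uC]|/no_up_cyclic free] := boolP [exists C, up_cyclic W C]; last first.
  exact: (cyclic_free_shallow circ comp free).
have [/existsP[D uD]|/no_up_cyclic free] :=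
  boolP [exists D, up_cyclic (complements W) D]; last first.
  by apply: (cyclic_free_shallow circ compC free); rewrite ?complementsK // setUC.
exact: (two_triples_shallow comp sHW uC uD).
Qed.

Lemma compatible_up_shallow (H : {set {set V}}) :
  compatible arc H -> containment_free H -> set0 \notin H ->
  exists R, shallow_hitting_set 3 H R.
Proof.
move=> comp cfH H0.
have [/existsP[C uC]|/no_up_cyclic free] := boolP [exists C, up_cyclic H C].
  by exists C; apply: up_cyclic_shallow.
have [|R hR] := up_edges_shallow circ comp free (subsetUl _ _) cfH H0; first by [].
by exists R => E /hR/andP[-> /leq_trans->].
Qed.

End TwoTriples.

(** * Signed linear orders *)

Section SignedArc.
Context (V : finType) (r : V -> nat) (s : {pred V}).
Hypothesis r_inj : injective r.

(** The order is given by an injective rank; [s] is the set of negative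
vertices. *)
Definition signed_arc : rel V :=
  fun x y => (x != y) && ((r x < r y) (+) ((x \in s) (+) (y \in s))).

Lemma signed_arc_lt x y : signed_arc x y ->
  if (x \in s) (+) (y \in s) then r y < r x else r x < r y.
Proof.
rewrite /signed_arc => /andP[nxy]; case: (_ (+) (y \in s)); last by rewrite addbF.
by rewrite addbT -leqNgt leq_eqVlt (inj_eq r_inj) eq_sym (negPf nxy).
Qed.

Lemma signed_circular : circular signed_arc.
Proof.
split=> [x|x y nxy|t x y z|t x y z].
- by rewrite /signed_arc eqxx.
- rewrite /signed_arc eq_sym nxy /= [(y \in s) (+) _]addbC -addNb; congr (_ (+) _).
  by rewrite ltn_neqAle (inj_eq r_inj) eq_sym nxy leqNgt.
- move=> /signed_arc_lt tx /signed_arc_lt ty /signed_arc_lt tz.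
  apply/negP=> /and3P[/signed_arc_lt xy /signed_arc_lt yz /signed_arc_lt zx].
  move: tx ty tz xy yz zx.
  by case: (t \in s); case: (x \in s); case: (y \in s); case: (z \in s) => /=; lia.
- move=> /signed_arc_lt tx /signed_arc_lt ty /signed_arc_lt tz.
  apply/negP=> /and3P[/signed_arc_lt xy /signed_arc_lt yz /signed_arc_lt zx].
  move: tx ty tz xy yz zx.
  by case: (t \in s); case: (x \in s); case: (y \in s); case: (z \in s) => /=; lia.
Qed.

End SignedArc.

Lemma in_symdiff (V : finType) (A B : {set V}) x :
  (x \in symdiff A B) = (x \in A) (+) (x \in B).
Proof. by rewrite !inE; case: (x \in A); case: (x \in B). Qed.

Lemma symdiffC (V : finType) (A X : {set V}) : symdiff (~: A) X = ~: symdiff A X.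
Proof. by apply/setP=> x; rewrite in_setC !in_symdiff in_setC addNb. Qed.

(** For each choice of signs and arcs that occurs on a triple, both rules of
[compatible] become the ABA condition for the triple in increasing order,
possibly with the two sets exchanged. *)
Lemma signed_compatible (V : finType) (r : V -> nat) (F : {set {set V}}) (X : {set V}) :
  injective r ->
  (forall A B x y z, A \in F -> B \in F -> r x < r y -> r y < r z ->
     x \in A -> x \notin B -> z \in A -> z \notin B -> y \notin A -> y \in B -> False) ->
  compatible (signed_arc r (mem X)) [set symdiff E X | E in F].
Proof.
move=> r_inj aba _ _ /imsetP[A AF ->] /imsetP[B BF ->] x y z.
have sub v C D : v \in symdiff C X :\: symdiff D X ->
    if v \in X then (v \notin C) /\ (v \in D) else (v \in C) /\ (v \notin D).
  rewrite in_setD !in_symdiff.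
  by case: (v \in X); case: (v \in C); case: (v \in D).
have ab p q t := aba A B p q t AF BF; have ba p q t := aba B A p q t BF AF.
have arc_lt := signed_arc_lt r_inj.
split=> /and3P[/arc_lt a1 /arc_lt a2 /arc_lt a3];
  case=> /sub + /sub + /sub; move: a1 a2 a3;
  case: (x \in X); case: (y \in X); case: (z \in X);
  move=> /= a1 a2 a3 [x1 x2] [z1 z2] [y1 y2];
  first [ by apply: (ab x y z) | by apply: (ab x z y) | by apply: (ab y x z)
        | by apply: (ab y z x) | by apply: (ab z x y) | by apply: (ab z y x)
        | by apply: (ba x y z) | by apply: (ba x z y) | by apply: (ba y x z)
        | by apply: (ba y z x) | by apply: (ba z x y) | by apply: (ba z y x)
        | by lia ].
Qed.

(** * Ranks and the lexicographic order *)

Section Rank.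
Context (V : finType) (lt : rel V).
Hypothesis irr : irreflexive lt.
Hypothesis tr : transitive lt.
Hypothesis tot : forall x y, x != y -> lt x y || lt y x.

Definition rank (x : V) : nat := #|[set y | lt y x]|.

Lemma rank_mono x y : lt x y -> rank x < rank y.
Proof.
move=> xy; apply/proper_card/properP; split; last first.
  by exists x; rewrite !inE ?irr.
by apply/subsetP=> z; rewrite !inE => zx; apply: tr xy.
Qed.

Lemma rank_inj : injective rank.
Proof.
move=> x y exy; apply/eqP/negPn/negP=> /tot/orP[]/rank_mono.
  by rewrite exy ltnn.
by rewrite exy ltnn.
Qed.

Lemma rank_lt x y : rank x < rank y -> lt x y.
Proof.
move=> rxy; have nxy : x != y by apply: contraTneq rxy => ->; rewrite ltnn.
have /orP[//|/rank_mono] := tot nxy.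
by rewrite ltnNge ltnW.
Qed.

End Rank.

Section Lex.
Context (d : Order.disp_t) (S : finOrderType d).

(** Lexicographic order on sets, the set containing the least differing element
coming first. *)
Definition lexlt (f g : {set S}) : bool :=
  [exists v in f :\: g, [forall u, (u < v)%O ==> ((u \in f) == (u \in g))]].

Lemma lexltP (f g : {set S}) : reflect
  (exists v, [/\ v \in f, v \notin g & forall u, (u < v)%O -> (u \in f) = (u \in g)])
  (lexlt f g).
Proof.
apply: (iffP exists_inP) => [[v /setDP[vf vg] /forall_inP h]|[v [vf vg h]]].
  by exists v; split=> // u /h /eqP.
by exists v; [rewrite inE vg|apply/forall_inP=> u /h ->].
Qed.

Lemma lexlt_irr : irreflexive lexlt.
Proof. by move=> f; apply/lexltP=> -[v [vf]]; rewrite vf. Qed.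

Lemma lexlt_trans : transitive lexlt.
Proof.
move=> g f h /lexltP[v [vf vg fg]] /lexltP[w [wg wh gh]]; apply/lexltP.
have [vw|wv|evw] := ltgtP v w.
- exists v; split; rewrite -?gh // => u uv.
  by rewrite fg // gh // (lt_trans uv).
- exists w; split; rewrite ?fg // => u uw.
  by rewrite fg ?gh // (lt_trans uw).
- by rewrite evw wg in vg.
Qed.

Lemma lexlt_total (f g : {set S}) : f != g -> lexlt f g || lexlt g f.
Proof.
move=> nfg; have [v0 v0P] : exists v, (v \in f) != (v \in g).
  apply/existsP; apply: contraNT nfg => /existsPn h.
  by apply/eqP/setP=> v; have /negPn/eqP := h v.
pose P v := (v \in f) != (v \in g).
case: (@arg_minP _ _ _ v0 P id v0P) => v vP minv.
have agree u : (u < v)%O -> (u \in f) = (u \in g).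
  move=> uv; apply/eqP/negPn/negP=> /minv /(lt_le_trans uv).
  by rewrite ltxx.
apply/orP; have [vf|vf] := boolP (v \in f); [left|right]; apply/lexltP;
  exists v; split=> //; move: vP; rewrite /P.
- by rewrite vf; case: (v \in g).
- by rewrite (negPf vf); case: (v \in g).
- by move=> _ u /agree.
Qed.

(** In an ABA-free family, the differences of two members are separated; the
lexicographic order tells which difference comes first. *)
Lemma lexlt_ABA (F : {set {set S}}) (f g : {set S}) v w :
  ABA_free F -> f \in F -> g \in F ->
  lexlt f g -> v \in f :\: g -> w \in g :\: f -> (v < w)%O.
Proof.
move=> aba fF gF /lexltP[u [uf ug fg]] /[dup] vfg /setDP[vf vg] /[dup] wgf /setDP[wg wf].
have [//|wv|evw] := ltgtP v w; last by rewrite -evw vf in wf.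
have [uw|wu|euw] := ltgtP u w.
- by case: (aba f g fF gF); exists u, w, v; split=> //; rewrite inE uf ug.
- by rewrite fg ?wg in wf.
- by rewrite -euw uf in wf.
Qed.

End Lex.

(** * The two hypergraph classes *)

Lemma pseudohemisphere_shallow (d : Order.disp_t) (S : finOrderType d)
    (H : {set {set S}}) :
  pseudohemisphere_hypergraph H -> containment_free H ->
  exists R : {set S}, shallow_hitting_set 4 H R.
Proof.
move=> [[E EH E0] [X [F [_ aba sHF]]]] cfH.
pose lt : rel S := fun x y => (x < y)%O.
have lt_irr : irreflexive lt by move=> x; apply: ltxx.
have lt_tr : transitive lt by move=> y x z; apply: lt_trans.
have lt_tot x y : x != y -> lt x y || lt y x.
  exact: lt_total.
have r_inj := rank_inj lt_irr lt_tr lt_tot.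
pose W := [set symdiff A X | A in F].
have comp : compatible (signed_arc (rank lt) (mem X)) W.
  apply: signed_compatible => // A B x y z AF BF.
  move=> /(rank_lt lt_irr lt_tr lt_tot) xy /(rank_lt lt_irr lt_tr lt_tot) yz.
  move=> xA xB zA zB yA yB; apply: (aba A B AF BF); exists x, y, z.
  by rewrite !inE xA xB zA zB yA yB.
apply: (compatible_shallow (signed_circular _ r_inj) comp) => //.
  apply: (subset_trans sHF); apply/subsetP=> _ /imsetP[A AF ->].
  move: AF; rewrite !in_setU !complementsP -symdiffC => /orP[AF|AF].
    by apply/orP; left; apply: imset_f.
  by apply/orP; right; apply: imset_f.
by apply: contra E0 => H0; rewrite -(cfH _ _ H0 EH) ?sub0set.
Qed.

Lemma dual_pseudohalfplane_shallow (d : Order.disp_t) (S : finOrderType d)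
    (H : {set {set S}}) :
  pseudohalfplane_hypergraph H -> containment_free (dual H) ->
  exists R : {set {E : {set S} | E \in H}}, shallow_hitting_set 3 (dual H) R.
Proof.
move=> [[E0 E0H /set0Pn[v0 v0E0]] [F [_ aba sHF]]] cfH.
pose V : finType := {E : {set S} | E \in H}.
(* f E is E or its complement, and lies in F; X is the set of those E for which
   it is the complement. *)
pose f (E : V) := if val E \in F then val E else ~: val E.
pose X : {set V} := [set E | val E \notin F].
(* Two distinct vertices with the same image under f are complementary and exactly one
   of them is in X, which breaks the tie. *)
pose lt : rel V := fun x y =>
  lexlt (f x) (f y) || [&& f x == f y, x \notin X & y \in X].
have fF x : f x \in F.
  rewrite /f; case: ifPn => // xF; move/(subsetP sHF): (valP x).
  by rewrite inE complementsP (negPf xF).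
have lt_irr : irreflexive lt.
  by move=> x; rewrite /lt lexlt_irr eqxx; case: (x \in X).
have lt_tr : transitive lt.
  move=> y x z /orP[xy|/and3P[/eqP exy xX yX]] /orP[yz|/and3P[/eqP eyz yX' zX]];
    rewrite /lt.
  - by rewrite (lexlt_trans xy yz).
  - by rewrite -eyz xy.
  - by rewrite exy yz.
  - by rewrite yX in yX'.
have lt_tot x y : x != y -> lt x y || lt y x.
  move=> nxy; rewrite /lt; have [exy|nf] := eqVneq (f x) (f y); last first.
    by have /orP[->|->] := lexlt_total nf; rewrite ?orbT.
  rewrite exy lexlt_irr /= !inE; move: exy; rewrite /f.
  case: ifPn => xF; case: ifPn => yF //=.
    by move/val_inj=> exy; rewrite exy eqxx in nxy.
  by move/(can_inj (@setCK S))/val_inj=> exy; rewrite exy eqxx in nxy.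
have r_inj := rank_inj lt_irr lt_tr lt_tot.
pose G := [set [set E : V | v \in f E] | v : S].
have dualE : dual H = [set symdiff A X | A in G].
  rewrite -imset_comp; apply: eq_imset => v; apply/setP=> E /=.
  rewrite in_symdiff !inE /f; case: ifPn => EF; first by rewrite addbF.
  by rewrite inE addbT negbK.
have comp : compatible (signed_arc (rank lt) (mem X)) (dual H).
  rewrite dualE; apply: signed_compatible => // _ _ x y z /imsetP[v _ ->] /imsetP[w _ ->].
  move=> /(rank_lt lt_irr lt_tr lt_tot) xy /(rank_lt lt_irr lt_tr lt_tot) yz.
  rewrite !inE => vx wx vz wz vy wy.
  have nxy : lexlt (f x) (f y).
    by case/orP: xy => // /and3P[/eqP exy _ _]; rewrite -exy vx in vy.
  have nyz : lexlt (f y) (f z).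
    by case/orP: yz => // /and3P[/eqP eyz _ _]; rewrite eyz vz in vy.
  have vw : (v < w)%O by apply: (lexlt_ABA aba _ _ nxy); rewrite ?inE ?vx ?wx ?vy.
  have wv : (w < v)%O by apply: (lexlt_ABA aba _ _ nyz); rewrite ?inE ?vz ?wz ?vy.
  by have := lt_trans vw wv; rewrite ltxx.
apply: (compatible_up_shallow (signed_circular _ r_inj) comp cfH).
apply/negP=> H0; have v0H : [set E : V | v0 \in val E] \in dual H by apply: imset_f.
have /setP/(_ (exist _ E0 E0H)) := cfH _ _ H0 v0H (sub0set _).
by rewrite !inE v0E0.
Qed.

Theorem theorem4p6 :
  (forall (d : Order.disp_t) (S : finOrderType d) (H : {set {set S}}),
     pseudohalfplane_hypergraph H ->
     containment_free (dual H) ->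
     exists R : {set {E : {set S} | E \in H}}, shallow_hitting_set 3 (dual H) R)
  /\
  (forall (d : Order.disp_t) (S : finOrderType d) (H : {set {set S}}),
     pseudohemisphere_hypergraph H ->
     containment_free H ->
     exists R : {set S}, shallow_hitting_set 4 H R).
Proof.
split; [exact: dual_pseudohalfplane_shallow|exact: pseudohemisphere_shallow].
Qed.
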